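(* For a word $w$ over positive integers without repeated letters, define the increasing binary tree $\operatorname{Tree}(w)$ recursively: the empty word gives the empty tree; otherwise write $w=w'\xi w''$ with $\xi=\min(w)$ and let $\operatorname{Tree}(w)$ have root $\xi$, left subtree $\operatorname{Tree}(w')$ and right subtree $\operatorname{Tree}(w'')$. The level of a letter of $w$ is the distance (number of edges) from its node to the root of $\operatorname{Tree}(w)$. For a permutation $\sigma=\sigma_1\cdots\sigma_n$ with border convention $\sigma_0=\sigma_{n+1}=-\infty$, $\sigma_j$ is a valley if $\sigma_{j-1}>\sigma_j<\sigma_{j+1}$. Let $X_n$ be the number of permutations of $\{1,\dots,n\}$ in which every element at odd level is a valley, and $Y_n$ the number in which every element at even level is a valley ($Y_0=1$, counting the empty permutation). Then $$\sum_{n\ge0}X_n\frac{z^n}{n!}=\operatorname{smh}(z)=-\operatorname{sm}(-z),\qquad \sum_{n\ge0}Y_n\frac{z^n}{n!}=\operatorname{cmh}(z)=\operatorname{cm}(-z),$$ where $\operatorname{sm},\operatorname{cm}$ are analytic near $0$ with $\operatorname{sm}'=\operatorname{cm}^2$, $\operatorname{cm}'=-\operatorname{sm}^2$, $\operatorname{sm}(0)=0$, $\operatorname{cm}(0)=1$.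
   Formalization: X_0 is taken to be 0 (the empty permutation is not counted in X_n), since counting it, as the condition holding vacuously would require, gives constant term 1 whereas smh(0)=0. *)

(* Defs.v *)
From mathcomp Require Import all_boot all_fingroup.
From Stdlib Require Import Reals.
From Coquelicot Require Import Coquelicot.

Set Implicit Arguments.
Unset Strict Implicit.
Unset Printing Implicit Defensive.

Local Open Scope nat_scope.

Inductive bintree := Leaf | Node of bintree & nat & bintree.

Fixpoint labels (t : bintree) : seq nat :=
  if t is Node l x r then labels l ++ x :: labels r else [::].

(* Number of edges from the root of [t] to the node labelled [x]; meaningful
   when [x] labels exactly one node of [t]. *)
Fixpoint depth (x : nat) (t : bintree) : nat :=
  if t is Node l y r then
    if x == y then 0
    else (if x \in labels l then depth x l else depth x r).+1
  else 0.

Definition minletter (w : seq nat) : nat := foldr minn (head 0 w) w.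

(* [k] bounds the recursion depth; any [k >= size w] gives the same tree. *)
Fixpoint Tree_rec (k : nat) (w : seq nat) : bintree :=
  match k, w with
  | k'.+1, _ :: _ =>
      let xi := minletter w in
      let i := index xi w in
      Node (Tree_rec k' (take i w)) xi (Tree_rec k' (drop i.+1 w))
  | _, _ => Leaf
  end.

Definition Tree (w : seq nat) : bintree := Tree_rec (size w) w.

Lemma minletter_mem w : w != [::] -> minletter w \in w.
Proof.
case: w => // x w _; rewrite /minletter [head _ _]/=.
suff: foldr minn x (x :: w) \in x :: (x :: w) by rewrite inE => /predU1P[->|//]; apply: mem_head.
elim: (x :: w) => [|y s IHs]; first by rewrite mem_head.
rewrite /= /minn; case: ltnP => _; first by rewrite !inE eqxx orbT.
by move: IHs; rewrite !inE => /orP[->//|->]; rewrite !orbT.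
Qed.

Lemma Tree_rec_size k w : size w <= k -> Tree_rec k w = Tree w.
Proof.
rewrite /Tree.
have [n] := ubnP (size w); elim: n w k => // n IHn [|x w] [|k] //= lt_wn le_wk.
set u := x :: w; set m := minletter u; set i := index m u.
have le_i : i <= size w by rewrite -ltnS -[(size w).+1]/(size u) index_mem minletter_mem.
have sz_l : size (take i u) <= size w.
  by apply: leq_trans le_i; rewrite size_take_min geq_minl.
have sz_r : size (drop i.+1 u) <= size w by rewrite size_drop subSS leq_subr.
have IH v : size v <= size w -> Tree_rec k v = Tree_rec (size w) v.
  move=> le_v; have lt_v : size v < n by apply: leq_ltn_trans le_v lt_wn.
  by rewrite !IHn // (leq_trans le_v).
by rewrite !IH.
Qed.

Lemma Tree_nil : Tree [::] = Leaf.
Proof. by []. Qed.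

Lemma Tree_split (w' w'' : seq nat) (xi : nat) :
  (forall x, x \in w' ++ w'' -> xi < x) ->
  Tree (w' ++ xi :: w'') = Node (Tree w') xi (Tree w'').
Proof.
move=> min_xi; set w := w' ++ xi :: w''.
have w_neq0 : w != [::] by rewrite /w; case: (w').
have xi_w : xi \in w by rewrite mem_cat mem_head orbT.
have le_min (s : seq nat) a x : x \in s -> foldr minn a s <= x.
  elim: s => //= y s IHs; rewrite inE geq_min => /predU1P[->|/IHs->].
    by rewrite leqnn.
  by rewrite orbT.
have min_w : minletter w = xi.
  apply/eqP; rewrite eqn_leq le_min //=.
  have := minletter_mem w_neq0; rewrite mem_cat inE orbCA -mem_cat.
  by case/predU1P=> [->//|/min_xi/ltnW].
have xi_w' : xi \notin w'.
  by apply/negP=> xi_w'; have := min_xi xi; rewrite mem_cat xi_w' ltnn => /(_ isT).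
have idx : index xi w = size w' by rewrite index_cat (negPf xi_w') /= eqxx addn0.
have sz : size w = (size w' + size w'').+1 by rewrite size_cat addnS.
have -> : Tree w = Node (Tree_rec (size w' + size w'') (take (index (minletter w) w) w))
    (minletter w) (Tree_rec (size w' + size w'') (drop (index (minletter w) w).+1 w)).
  by rewrite /Tree sz; case: (w) w_neq0.
rewrite min_w idx take_size_cat // /w -cat_rcons drop_size_cat ?size_rcons //.
by rewrite !Tree_rec_size ?leq_addr ?leq_addl.
Qed.

Definition level (w : seq nat) (x : nat) : nat := depth x (Tree w).

(* The j-th letter of [w], counted from 1. The border value -oo, for [j = 0]
   and [j = size w + 1], is encoded as 0, which is below every letter since
   letters are positive. *)
Definition letter (w : seq nat) (j : nat) : nat := nth 0 (0 :: w) j.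

Definition valley (w : seq nat) (j : nat) : bool :=
  (letter w j < letter w j.-1) && (letter w j < letter w j.+1).

(* A permutation of {1, ..., n} is represented by a permutation of
   {0, ..., n-1}; its word is the one-line notation with values shifted by 1. *)
Definition word (n : nat) (s : 'S_n) : seq nat :=
  [seq (s i).+1 | i <- enum 'I_n].

Definition odd_levels_valleys (n : nat) (s : 'S_n) : bool :=
  [forall i : 'I_n, odd (level (word s) (letter (word s) i.+1))
                    ==> valley (word s) i.+1].

Definition even_levels_valleys (n : nat) (s : 'S_n) : bool :=
  [forall i : 'I_n, ~~ odd (level (word s) (letter (word s) i.+1))
                    ==> valley (word s) i.+1].

(* The empty permutation is counted in Y_0 but not in X_0: smh has constant
   term 0. *)
Definition X (n : nat) : nat :=
  #|[set s : 'S_n | (0 < n) && odd_levels_valleys s]|.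

Definition Y (n : nat) : nat := #|[set s : 'S_n | even_levels_valleys s]|.

Definition egf (u : nat -> nat) (n : nat) : C :=
  RtoC (INR (u n) / INR n`!)%R.

(* Series and derivatives are over the complex field: C is a normed module over
   itself, so [has_derive_at] is complex differentiability. *)
Definition has_pseries_at (a : nat -> C) (x l : C) : Prop :=
  @is_pseries C_AbsRing C_NormedModule a x l.

Definition has_derive_at (f : C -> C) (z l : C) : Prop :=
  @is_derive C_AbsRing C_NormedModule f z l.

Definition near (c : C) (P : C -> Prop) : Prop := @locally C_UniformSpace c P.

(* [f] is the sum of a convergent power series centred at [c] throughout a
   neighbourhood of [c], hence analytic at every point near [c]. *)
Definition analytic_near (c : C) (f : C -> C) : Prop :=
  exists a : nat -> C, near c (fun z => has_pseries_at a (z - c)%C (f z)).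

Definition smh (sm : C -> C) (z : C) : C := (- sm (- z))%C.
Definition cmh (cm : C -> C) (z : C) : C := cm (- z)%C.

(* Main.v *)
Require Import Defs.
From mathcomp Require Import all_boot all_fingroup.
From Stdlib Require Import Reals.
From Coquelicot Require Import Coquelicot.
From mathcomp Require Import zify.
From Stdlib Require Import Lra.

Set Implicit Arguments.
Unset Strict Implicit.
Unset Printing Implicit Defensive.

(** A valley is a letter whose node has both children in [Tree w], because the
    minimum that splits the word acts as a border for both halves. Removing the
    minimum shifts all levels by one and so exchanges the two parity conditions:
    [X (n+1)] is the binomial convolution of [Y] with itself and [Y (n+1)] that
    of [X] with itself. This says smh' = cmh^2 and cmh' = smh^2 for the
    exponential generating functions.

    On the analytic side, real and imaginary parts of [sm] and [cm] along the
    real axis are real power series, for which termwise differentiation, Cauchy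
    products and uniqueness of coefficients are available. The differential
    equations thus become the same recurrences, up to signs, for the complex
    Taylor coefficients, and a power series is determined by them. *)

Section Combinatorics.
Local Open Scope nat_scope.

(** * Levels and valleys when a word is split at its minimum *)

Lemma split_minletter (w : seq nat) (m : nat) :
  m \in w -> uniq w -> (forall x : nat, x \in w -> m <= x) ->
  exists w1 w2, w = w1 ++ m :: w2 /\ forall x : nat, x \in w1 ++ w2 -> m < x.
Proof.
move=> m_w; case/splitPr: m_w => w1 w2 uw min_m; exists w1, w2; split=> // x x_w.
have x_w' : x \in w1 ++ m :: w2 by move: x_w; rewrite !mem_cat inE => /orP[]->; rewrite ?orbT.
rewrite ltn_neqAle min_m // andbT; apply: contraTneq uw => ->.
by rewrite (uniq_catCA w1 [:: x]) /= x_w.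
Qed.

(** [depth] chooses a subtree by membership in its labels, so level computations need to know that
    no letter is lost or created. *)
Lemma mem_labels_Tree (w : seq nat) : uniq w -> labels (Tree w) =i w.
Proof.
have [n] := ubnP (size w); elim: n w => // n IHn w lt_wn uw.
have [->//|w_neq0] := eqVneq w [::].
have min_m x : x \in w -> minletter w <= x.
  rewrite /minletter; elim: (w) (head 0 w) => //= y s IHs a.
  by rewrite inE geq_min => /predU1P[->|/IHs->]; rewrite ?leqnn ?orbT.
have [w1 [w2 [def_w gt_m]]] := split_minletter (minletter_mem w_neq0) uw min_m.
move: (minletter w) def_w gt_m => m def_w gt_m; subst w.
rewrite Tree_split //; move: uw lt_wn.
rewrite cat_uniq /= size_cat addnS => /and3P[u1 _ /andP[_ u2]]; rewrite ltnS => lt_wn x.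
rewrite /= !mem_cat !inE !IHn //; apply: leq_ltn_trans lt_wn.
  exact: leq_addl.
exact: leq_addr.
Qed.

Lemma level_min (w1 w2 : seq nat) (m : nat) :
  (forall x : nat, x \in w1 ++ w2 -> m < x) -> level (w1 ++ m :: w2) m = 0.
Proof. by move=> gt_m; rewrite /level Tree_split //= eqxx. Qed.

Lemma level_left (w1 w2 : seq nat) (m x : nat) :
  uniq w1 -> (forall y : nat, y \in w1 ++ w2 -> m < y) -> x \in w1 ->
  level (w1 ++ m :: w2) x = (level w1 x).+1.
Proof.
move=> u1 gt_m x1; rewrite /level Tree_split //=.
have := gt_m x; rewrite mem_cat x1 => /(_ isT) lt_mx.
by rewrite gtn_eqF // mem_labels_Tree // x1.
Qed.

Lemma level_right (w1 w2 : seq nat) (m x : nat) :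
  uniq w1 -> (forall y : nat, y \in w1 ++ w2 -> m < y) -> x \notin w1 -> x \in w2 ->
  level (w1 ++ m :: w2) x = (level w2 x).+1.
Proof.
move=> u1 gt_m x1 x2; rewrite /level Tree_split //=.
have := gt_m x; rewrite mem_cat x2 orbT => /(_ isT) lt_mx.
by rewrite gtn_eqF // mem_labels_Tree // (negPf x1).
Qed.

(** Only the last letter of [w1] gets a new neighbour: [m] in place of the border 0. Both lie below
    every letter of [w1], so the comparison is unaffected. *)
Lemma valley_left (w1 w2 : seq nat) (m i : nat) :
  (forall y : nat, y \in w1 -> m < y) -> i < size w1 ->
  valley (w1 ++ m :: w2) i.+1 = valley w1 i.+1.
Proof.
move=> gt_m lti; rewrite /valley /letter -cat_cons /=.
rewrite -[0 :: w1 ++ _]cat_cons !nth_cat /= lti ltnS (ltnW lti).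
congr (_ && _); case: (ltnP i.+1) => // le_i; rewrite [nth 0 w1 i.+1]nth_default //.
have -> : i.+1 - size w1 = 0 by lia.
by apply/idP/idP=> //=; rewrite ltnNge ltnW // gt_m // mem_nth.
Qed.

(** Symmetric to [valley_left]: the first letter of [w2] has [m] in place of the border 0 on its
    left. *)
Lemma valley_right (w1 w2 : seq nat) (m i : nat) :
  (forall y : nat, y \in w2 -> m < y) -> i < size w2 ->
  valley (w1 ++ m :: w2) (size w1 + i.+1).+1 = valley w2 i.+1.
Proof.
move=> gt_m lti; rewrite /valley /letter /= -[0 :: w1 ++ _]cat_cons !nth_cat /=.
have -> : (size w1 + i.+1 < size w1) = false by lia.
have -> : (size w1 + i.+1 < (size w1).+1) = false by lia.
have -> : ((size w1 + i.+1).+1 < size w1) = false by lia.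
have -> : size w1 + i.+1 - size w1 = i.+1 by lia.
have -> : size w1 + i.+1 - (size w1).+1 = i by lia.
have -> : (size w1 + i.+1).+1 - size w1 = i.+2 by lia.
congr (_ && _); case: i lti => //= lt0.
by apply/idP/idP=> //=; rewrite ltnNge ltnW // gt_m // mem_nth.
Qed.

(** Next to an empty side the neighbour of [m] is the border 0, which is not above [m]; any other
    neighbour is. *)
Lemma valley_min (w1 w2 : seq nat) (m : nat) :
  (forall y : nat, y \in w1 ++ w2 -> m < y) ->
  valley (w1 ++ m :: w2) (size w1).+1 = (w1 != [::]) && (w2 != [::]).
Proof.
move=> gt_m; rewrite /valley /letter /= -[0 :: w1 ++ _]cat_cons !nth_cat /=.
have -> : ((size w1).+1 < size w1) = false by lia.
rewrite ltnn ltnSn subnn subSnn /=; congr (_ && _).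
  case: w1 gt_m => // x w1 gt_m; apply: gt_m.
  by rewrite mem_cat; apply/orP; left; apply: (@mem_nth _ 0 (x :: w1) (size w1)) => /=.
by case: w2 gt_m => // x w2 gt_m; apply: gt_m; rewrite mem_cat mem_head orbT.
Qed.

(* The conjunct on the empty word encodes [X 0 = 0]: since a minimum is a valley
   exactly when both its subtrees are nonempty, excluding the empty word for
   [b = true] makes [good_split] uniform in [b]. *)
Definition good (b : bool) (w : seq nat) : bool :=
  (b ==> (w != [::])) &&
  all (fun i => (odd (level w (nth 0 w i)) == b) ==> valley w i.+1)
      (seq.iota 0 (size w)).

Lemma good_split (b : bool) (w1 w2 : seq nat) (m : nat) :
  uniq (w1 ++ w2) -> (forall y : nat, y \in w1 ++ w2 -> m < y) ->
  good b (w1 ++ m :: w2) = good (~~ b) w1 && good (~~ b) w2.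
Proof.
move=> uw gt_m; have := uw; rewrite cat_uniq => /and3P[u1 /hasPn disj u2].
have gt1 y : y \in w1 -> m < y by move=> h; rewrite gt_m // mem_cat h.
have gt2 y : y \in w2 -> m < y by move=> h; rewrite gt_m // mem_cat h orbT.
rewrite /good size_cat /= iotaD all_cat /= add0n.
rewrite nth_cat ltnn subnn level_min // valley_min //=.
set A1 := all _ (seq.iota 0 (size w1)); set A2 := all _ (seq.iota _ _).
set B1 := all _ (seq.iota 0 (size w1)); set B2 := all _ (seq.iota 0 (size w2)).
have -> : A1 = B1.
  apply: eq_in_all => i; rewrite mem_iota add0n => /= lti.
  rewrite nth_cat lti valley_left // level_left ?mem_nth //=.
  by rewrite eqb_negLR.
have -> : A2 = B2.
  rewrite /A2 -[(size w1).+1]addn0 iotaDl all_map; apply: eq_in_all => i.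
  rewrite mem_iota add0n => /= lti; rewrite addSnnS valley_right //.
  have -> : nth 0 (w1 ++ m :: w2) (size w1 + i.+1) = nth 0 w2 i.
    by rewrite nth_cat ltnNge leq_addr /= addKn.
  rewrite level_right ?mem_nth ?disj ?mem_nth //=.
  by rewrite eqb_negLR.
have -> : w1 ++ m :: w2 != [::] by case: (w1).
(* For [b = true] the minimum, at level 0, is unconstrained and the halves may be empty. For
   [b = false] it must be a valley, which supplies the two nonemptiness conjuncts of [good true]. *)
rewrite implybT /=; clearbody B1 B2; clear A1 A2; case: b => //=.
by case: (w1 != _); case: (w2 != _); case: B1; case: B2.
Qed.

(** * Distributing letters over the two sides of the minimum *)

(** These are the pairs (subset, complement) of letters, each listed in the order of [t]; the
    arrangement of each side is chosen later by [permutations]. *)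
Fixpoint splits (t : seq nat) : seq (seq nat * seq nat) :=
  if t is x :: t' then
    [seq (x :: p.1, p.2) | p <- splits t'] ++
    [seq (p.1, x :: p.2) | p <- splits t']
  else [:: ([::], [::])].

Lemma splits_perm (t : seq nat) p : p \in splits t -> perm_eq (p.1 ++ p.2) t.
Proof.
elim: t p => [|x t IHt] p /=; first by rewrite inE => /eqP->.
rewrite mem_cat => /orP[] /mapP[q /IHt q_t ->] /=; first by rewrite perm_cons.
by rewrite (perm_catCA q.1 [:: x]) /= perm_cons.
Qed.

Lemma filter_splits (a : pred nat) (t : seq nat) :
  (filter a t, filter (predC a) t) \in splits t.
Proof.
elim: t => //= x t IHt; rewrite mem_cat.
by case: (a x) => /=; apply/orP; [left | right]; apply/mapP;
  exists (filter a t, filter (predC a) t).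
Qed.

(** A set of n letters has C(n,k) splits with k letters on the left. Placing one more letter shifts
    one argument of [f], so the induction is over all [f], and Pascal's rule merges the two sums. *)
Lemma sum_splits (f : nat -> nat -> nat) (t : seq nat) :
  \sum_(p <- splits t) f (size p.1) (size p.2) =
  \sum_(k < (size t).+1) 'C(size t, k) * f k (size t - k).
Proof.
elim: t f => [|x t IHt] f; first by rewrite big_seq1 big_ord1 mul1n.
rewrite /= big_cat !big_map /= (IHt (fun i j => f i.+1 j)) (IHt (fun i j => f i j.+1)).
set n := size t.
rewrite [RHS]big_ord_recl bin0 mul1n subn0.
under [in RHS]eq_bigr => i _ do rewrite binS subSS mulnDl.
rewrite big_split /= [X in _ = _ + (X + _)]big_ord_recr /= bin_small // mul0n addn0.
rewrite addnC [X in X + _ = _]big_ord_recl /= bin0 mul1n subn0 -addnA; congr (_ + (_ + _)).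
by apply: eq_bigr => i _; rewrite /bump /= add1n subnSK.
Qed.

Definition joins (m : nat) (t : seq nat) : seq (seq nat) :=
  flatten [seq [seq w1 ++ m :: w2 | w1 <- permutations p.1, w2 <- permutations p.2]
          | p <- splits t].

Lemma count_sum (T : Type) (P : pred T) (s : seq T) : count P s = \sum_(x <- s) P x.
Proof. by rewrite -sum1_count big_mkcond; apply: eq_bigr => x _; case: (P x). Qed.

Lemma count_joins (P : pred (seq nat)) (m : nat) (t : seq nat) :
  count P (joins m t) =
  \sum_(p <- splits t) \sum_(w1 <- permutations p.1) \sum_(w2 <- permutations p.2)
     P (w1 ++ m :: w2).
Proof.
rewrite count_flatten -map_comp sumnE big_map; apply: eq_bigr => p _ /=.
by rewrite count_sum big_allpairs_dep.
Qed.

(** With n letters in [t], each of the n+1 possible sizes k of the left side contributes C(n,k) k!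
    (n-k)! = n! words. *)
Lemma size_joins (m : nat) (t : seq nat) : uniq t -> size (joins m t) = (size t).+1`!.
Proof.
move=> ut; rewrite -count_predT count_joins.
rewrite (eq_big_seq (fun p => (size p.1)`! * (size p.2)`!)) => [|p p_t].
  rewrite (sum_splits (fun i j => i`! * j`!)) (eq_bigr (fun=> (size t)`!)).
    by rewrite sum_nat_const card_ord factS.
  by move=> i _; rewrite bin_fact // -ltnS.
have := ut; rewrite -(perm_uniq (splits_perm p_t)) cat_uniq => /and3P[u1 _ u2].
under eq_bigr do rewrite sum1_size size_permutations //.
by rewrite big_const_seq count_predT iter_addn_0 size_permutations // mulnC.
Qed.

Lemma permutations_sub_joins (m : nat) (t : seq nat) :
  uniq (m :: t) -> {subset permutations (m :: t) <= joins m t}.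
Proof.
move=> ut w; rewrite mem_permutations => w_mt.
have /splitPr def_w : m \in w by rewrite (perm_mem w_mt) mem_head.
case: w / def_w w_mt => w1 w2; rewrite (perm_catCA w1 [:: m]) /= perm_cons perm_sym => t_w.
move: ut => /= /andP[_ ut]; have := ut; rewrite (perm_uniq t_w) cat_uniq.
case/and3P=> u1 /hasPn disj u2.
apply/flattenP; eexists.
  (* The letters left and right of [m] are relisted in the order of [t], the form in which [splits]
     produces them. *)
  apply/mapP; exists (filter (mem w1) t, filter (predC (mem w1)) t) => //.
  exact: filter_splits.
apply: allpairs_f; rewrite mem_permutations; apply: uniq_perm; rewrite ?filter_uniq // => x;
  rewrite mem_filter /= (perm_mem t_w) mem_cat.
  by case: (x \in w1).
by have := disj x; case: (x \in w2) => [/(_ isT)/negPf->|] //=; case: (x \in w1).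
Qed.

(* Inclusion and equal cardinality [(n+1)!] already force [joins m t] to be
   duplicate-free, so injectivity of the decomposition need not be proved. *)
Lemma permutations_joins (m : nat) (t : seq nat) :
  uniq (m :: t) -> perm_eq (permutations (m :: t)) (joins m t).
Proof.
move=> ut; have um := permutations_uniq (m :: t).
have sub := permutations_sub_joins ut.
have le_sz : size (joins m t) <= size (permutations (m :: t)).
  by rewrite size_joins ?size_permutations //; case/andP: ut.
have [eq_sz eq_mem] := uniq_min_size um sub le_sz.
by apply: uniq_perm; rewrite // (leq_size_uniq um sub le_sz).
Qed.

(** * The recurrence for the number of good arrangements *)

Definition count_good (b : bool) (s : seq nat) : nat := count (good b) (permutations s).

(** By [good_split] the indicator of a joined word is a product of indicators of its halves, so the
    double sum over arrangements factors. *)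
Lemma count_good_cons (b : bool) (m : nat) (t : seq nat) :
  uniq t -> (forall y : nat, y \in t -> m < y) ->
  count_good b (m :: t) =
  \sum_(p <- splits t) count_good (~~ b) p.1 * count_good (~~ b) p.2.
Proof.
move=> ut gt_m; have umt : uniq (m :: t).
  by rewrite /= ut andbT; apply/negP => /gt_m; rewrite ltnn.
rewrite /count_good; have/seq.permP-> := permutations_joins umt.
rewrite count_joins; apply: eq_big_seq => p p_t.
rewrite !count_sum big_distrl /=; apply: eq_big_seq => w1 w1_p.
rewrite big_distrr /=; apply: eq_big_seq => w2 w2_p.
have w_t : perm_eq (w1 ++ w2) t.
  rewrite -(permPr (splits_perm p_t)) perm_cat // -mem_permutations //.
rewrite good_split ?(perm_uniq w_t) //.
  by case: good; case: good.
by move=> y; rewrite (perm_mem w_t); apply: gt_m.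
Qed.

Lemma count_good_perm (b : bool) (s t : seq nat) :
  perm_eq s t -> count_good b s = count_good b t.
Proof. by move=> /perm_permutations/seq.permP; apply. Qed.

(** Goodness depends only on relative order. Instead of transporting trees along an order
    isomorphism, the induction removes the minimum from both alphabets: the resulting sums involve
    only smaller alphabets, hence only sizes. *)
Lemma count_good_size (b : bool) (s : seq nat) :
  uniq s -> count_good b s = count_good b (seq.iota 1 (size s)).
Proof.
have [n] := ubnP (size s); elim: n b s => // n IHn b s lt_sn us.
rewrite -(count_good_perm b (permEl (perm_sort leq s))).
rewrite -(size_sort leq s); rewrite -(size_sort leq s) in lt_sn.
have : path.sorted ltn (sort leq s).
  by rewrite ltn_sorted_uniq_leq sort_uniq us sort_sorted //; apply: leq_total.
case: (sort leq s) lt_sn => // m t lt_tn /= st.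
have gt_m y : y \in t -> m < y by move/(allP (order_path_min ltn_trans st)).
have ut : uniq t by apply: (sorted_uniq ltn_trans ltnn); apply: path_sorted st.
pose g k := count_good (~~ b) (seq.iota 1 k).
(* Used twice: for the sorted tail [t] and for the tail of the interval starting at 1. *)
have sumE (r : seq nat) : uniq r -> size r < n ->
  \sum_(p <- splits r) count_good (~~ b) p.1 * count_good (~~ b) p.2 =
  \sum_(k < (size r).+1) 'C(size r, k) * (g k * g (size r - k)).
  move=> ur ltr; rewrite -(sum_splits (fun i j => g i * g j)).
  apply: eq_big_seq => p p_r; have e := splits_perm p_r.
  have := perm_size e; have := ur; rewrite -(perm_uniq e) cat_uniq size_cat.
  case/and3P=> u1 _ u2 sz; rewrite -sz in ltr.
  by rewrite /g -!IHn // (leq_ltn_trans _ ltr) ?leq_addl ?leq_addr.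
rewrite !count_good_cons ?iota_uniq // ?sumE ?iota_uniq ?size_iota //.
by move=> y; rewrite mem_iota => /andP[].
Qed.

Lemma count_good_recurrence (b : bool) (n : nat) :
  count_good b (seq.iota 1 n.+1) =
  \sum_(k < n.+1) 'C(n, k) *
    (count_good (~~ b) (seq.iota 1 k) * count_good (~~ b) (seq.iota 1 (n - k))).
Proof.
rewrite /= count_good_cons ?iota_uniq //; last by move=> y; rewrite mem_iota => /andP[].
pose g k := count_good (~~ b) (seq.iota 1 k).
rewrite -[in RHS](size_iota 2 n) -(sum_splits (fun i j => g i * g j)).
apply: eq_big_seq => p p_r; have e := splits_perm p_r.
have := iota_uniq 2 n; rewrite -(perm_uniq e) cat_uniq.
by case/and3P=> u1 _ u2; rewrite /g -!count_good_size.
Qed.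

(** * From words back to permutations *)

(** Again inclusion plus cardinality: [word] is injective, and both lists have n! entries. *)
Lemma map_word_perm (n : nat) :
  perm_eq (map (@word n) (enum 'S_n)) (permutations (seq.iota 1 n)).
Proof.
have word_inj : injective (@word n).
  move=> s1 s2 /eq_in_map eq_s; apply/permP=> i.
  by apply/val_inj; have [] := eq_s i (mem_enum _ i).
have uw : uniq (map (@word n) (enum 'S_n)) by rewrite map_inj_uniq ?enum_uniq.
have sub : {subset map (@word n) (enum 'S_n) <= permutations (seq.iota 1 n)}.
  move=> _ /mapP[s _ ->]; rewrite mem_permutations; apply: uniq_perm.
  - by rewrite map_inj_uniq ?enum_uniq // => i j [] /val_inj /perm_inj.
  - exact: iota_uniq.
  move=> x; rewrite mem_iota add1n ltnS; apply/mapP/andP=> [[i _ ->]|]; first by split.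
  case: x => [[]//|x [_ lt_xn]]; exists (s^-1 (Ordinal lt_xn))%g; rewrite ?mem_enum //.
  by rewrite permKV.
have le_sz : size (permutations (seq.iota 1 n)) <= size (map (@word n) (enum 'S_n)).
  by rewrite size_permutations ?iota_uniq // size_iota size_map -cardE card_Sn.
have [eq_sz eq_mem] := uniq_min_size uw sub le_sz.
by apply: uniq_perm; rewrite ?permutations_uniq.
Qed.

Lemma card_good (b : bool) (n : nat) :
  #|[set s : 'S_n | good b (word s)]| = count_good b (seq.iota 1 n).
Proof.
rewrite /count_good; have /seq.permP<- := map_word_perm n.
rewrite count_map count_sum big_enum -sum1_card [LHS]big_mkcond.
by apply: eq_bigr => s _ /=; rewrite inE; case: good.
Qed.

Lemma goodE (b : bool) (n : nat) (s : 'S_n) :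
  good b (word s) = (b ==> (0 < n)) &&
    [forall i : 'I_n, (odd (level (word s) (letter (word s) i.+1)) == b)
                      ==> valley (word s) i.+1].
Proof.
have sz : size (word s) = n by rewrite size_map -cardE card_ord.
rewrite /good -size_eq0 sz -lt0n; congr (_ && _).
apply/allP/forallP => [h i|h i]; first by apply: h; rewrite mem_iota /=.
by rewrite mem_iota => /= lti; apply: (h (Ordinal lti)).
Qed.

Lemma X_count_good (n : nat) : X n = count_good true (seq.iota 1 n).
Proof.
rewrite -card_good; apply: eq_card => s; rewrite !inE goodE.
by congr (_ && _); apply: eq_forallb => i; rewrite eqb_id.
Qed.

Lemma Y_count_good (n : nat) : Y n = count_good false (seq.iota 1 n).
Proof.
rewrite -card_good; apply: eq_card => s; rewrite !inE goodE.
by apply: eq_forallb => i; rewrite eqbF_neg.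
Qed.

Lemma X0 : X 0 = 0.
Proof. by rewrite X_count_good. Qed.

Lemma Y0 : Y 0 = 1.
Proof. by rewrite Y_count_good. Qed.

Lemma X_rec (n : nat) : X n.+1 = \sum_(k < n.+1) 'C(n, k) * (Y k * Y (n - k)).
Proof.
rewrite X_count_good count_good_recurrence.
by apply: eq_bigr => k _; rewrite !Y_count_good.
Qed.

Lemma Y_rec (n : nat) : Y n.+1 = \sum_(k < n.+1) 'C(n, k) * (X k * X (n - k)).
Proof.
rewrite Y_count_good count_good_recurrence.
by apply: eq_bigr => k _; rewrite !X_count_good.
Qed.

End Combinatorics.

Section Analysis.
Local Open Scope R_scope.

(** * Generating function coefficients and real power series *)

Lemma INR_sum_ord (F : nat -> nat) (n : nat) :
  INR (\sum_(k < n.+1) F k) = sum_f_R0 (fun k => INR (F k)) n.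
Proof.
elim: n => [|n IHn]; first by rewrite big_ord1.
by rewrite big_ord_recr [LHS]plus_INR IHn.
Qed.

Lemma INR_fact_neq0 (n : nat) : INR n`! <> 0.
Proof. by apply: not_0_INR; apply/eqP; rewrite -lt0n fact_gt0. Qed.

Definition coef (u : nat -> nat) (n : nat) : R := INR (u n) / INR n`!.

(** Division by n! turns the binomial convolution into a Cauchy product, so the recurrence reads U'
    = V^2 for formal series. *)
Lemma coef_PS_derive (u v : nat -> nat) (n : nat) :
  (forall m, u m.+1 = \sum_(k < m.+1) 'C(m, k) * (v k * v (m - k)))%nat ->
  PS_derive (coef u) n = PS_mult (coef v) (coef v) n.
Proof.
move=> u_rec; rewrite /PS_derive /coef factS [INR (_ * _)]mult_INR.
have nz := INR_fact_neq0; have nzS : INR n.+1 <> 0 by apply: not_0_INR.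
transitivity (INR (u n.+1) / INR n`!); first by field; split.
rewrite u_rec (INR_sum_ord (fun k => 'C(n, k) * (v k * v (n - k)))%nat).
rewrite /Rdiv Rmult_comm scal_sum; apply: sum_eq => k /leP le_kn.
rewrite -[in INR n`!](bin_fact le_kn) ![INR (_ * _)]mult_INR.
have nzC : INR 'C(n, k) <> 0 by apply: not_0_INR; apply/eqP; rewrite -lt0n bin_gt0.
rewrite minusE; by field; repeat split.
Qed.

Lemma pseries_radius (c : nat -> R) (f : R -> R) (r t : R) :
  (forall s, Rabs s < r -> is_pseries c s (f s)) -> Rabs t < r ->
  (* Convergence at [t] itself would only bound the radius weakly. At the midpoint [s] of |t| and
     [r] the terms tend to 0, which is impossible beyond the radius; hence the radius is at least
     [s], and [s] exceeds |t|. *)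
  Rbar_lt (Rabs t) (CV_radius c).
Proof.
move=> c_f lt_tr; pose s := (Rabs t + r) / 2.
have t0 := Rabs_pos t.
have s_abs : Rabs s = s by apply: Rabs_pos_eq; rewrite /s; lra.
have lt_sr : Rabs s < r by rewrite s_abs /s; lra.
apply: (@Rbar_lt_le_trans _ s); first by rewrite /= /s; lra.
apply: Rbar_not_lt_le => lt_rad.
apply: (@CV_disk_outside c s); first by rewrite s_abs.
have := ex_series_lim_0 _ (ex_intro _ _ (c_f s lt_sr)).
by apply: is_lim_seq_ext => n; rewrite pow_n_pow /scal /= /mult /= Rmult_comm.
Qed.

Lemma pseries_unique (c d : nat -> R) (f : R -> R) (r : R) (n : nat) :
  0 < r -> (forall t, Rabs t < r -> is_pseries c t (f t)) ->
  (forall t, Rabs t < r -> is_pseries d t (f t)) -> c n = d n.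
Proof.
move=> r_gt0 c_f d_f; have lt0r : Rabs 0 < r by rewrite Rabs_R0.
apply: PSeries_ext_recip.
- by have := pseries_radius c_f lt0r; rewrite Rabs_R0.
- by have := pseries_radius d_f lt0r; rewrite Rabs_R0.
exists (mkposreal r r_gt0) => t; rewrite /ball /= /AbsRing_ball /= /abs /minus /= /plus /opp /=.
rewrite Ropp_0 Rplus_0_r => lt_tr.
by rewrite (is_pseries_unique _ _ _ (c_f _ lt_tr)) (is_pseries_unique _ _ _ (d_f _ lt_tr)).
Qed.

Lemma pseries_derive (c : nat -> R) (f f' : R -> R) (r t : R) :
  (forall s, Rabs s < r -> is_pseries c s (f s)) ->
  (forall s, Rabs s < r -> is_derive f s (f' s)) ->
  Rabs t < r -> is_pseries (PS_derive c) t (f' t).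
Proof.
move=> c_f f_f' lt_tr; have rad := pseries_radius c_f lt_tr.
have -> : f' t = PSeries (PS_derive c) t.
  rewrite -(is_derive_unique _ _ _ (f_f' t lt_tr)).
  rewrite -(is_derive_unique _ _ _ (is_derive_PSeries _ _ rad)).
  apply: Derive_ext_loc.
  have d_gt0 : 0 < r - Rabs t by lra.
  exists (mkposreal _ d_gt0) => s; rewrite /ball /= /AbsRing_ball /= /abs /minus /= /plus /opp /=.
  move=> lt_st; symmetry; apply: is_pseries_unique; apply: c_f.
  (* The radius r - |t| keeps [s] inside the disk where [f] is the sum of its series, so the two
     derivatives at [t] agree. *)
  by have := Rabs_triang (s + - t) t; rewrite (_ : s + - t + t = s); [lra | ring].
by apply: PSeries_correct; apply: CV_radius_inside; rewrite CV_radius_derive.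
Qed.

(** * Restricting complex series and derivatives to the real axis *)

(* Applied to [Re] and [Im], which carry complex power series and derivatives
   on the real axis over to real ones. *)
Definition real_functional (pi : C -> R) : Prop :=
  [/\ forall x y : C, pi (x + y)%C = pi x + pi y,
      forall (r : R) (x : C), pi (RtoC r * x)%C = r * pi x
    & forall x : C, Rabs (pi x) <= Cmod x].

Lemma real_functional_Re : real_functional Re.
Proof. by split=> [x y|r x|x] //; [rewrite /Re /Cmult /=; ring | apply: re_le_Cmod]. Qed.

Lemma real_functional_Im : real_functional Im.
Proof.
split=> [x y|r x|x] //; first by rewrite /Im /Cmult /=; ring.
exact: Rle_trans (Rmax_r _ _) (Rmax_Cmod x).
Qed.

Lemma real_functional_minus (pi : C -> R) (x y : C) :
  real_functional pi -> pi (x - y)%C = pi x - pi y.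
Proof.
case=> piD piZ _; rewrite /Cminus piD (_ : - y = RtoC (-1) * y)%C; last first.
  by apply: injective_projections; rewrite /=; ring.
by rewrite piZ; ring.
Qed.

Lemma pow_n_RtoC (t : R) (n : nat) : @pow_n C_Ring (RtoC t) n = RtoC (t ^ n).
Proof. by elim: n => //= n ->; rewrite RtoC_mult. Qed.

(** Powers of a real [t] are real scalars, so [pi] passes through the partial sums; the bound by the
    modulus makes [pi] continuous and carries over the limit. *)
Lemma pseries_real_functional (pi : C -> R) (a : nat -> C) (t : R) (l : C) :
  real_functional pi -> has_pseries_at a (RtoC t) l ->
  is_pseries (fun n => pi (a n)) t (pi l).
Proof.
move=> pi_lin; have [piD piZ pi_le] := pi_lin.
rewrite /has_pseries_at /is_pseries /is_series => a_l.
have termE k : pi (scal (pow_n (RtoC t : C_AbsRing) k) (a k : C_NormedModule)) =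
               scal (pow_n t k) (pi (a k)).
  by rewrite pow_n_pow pow_n_RtoC [LHS]piZ.
apply: (filterlim_ext (fun n => pi (sum_n (fun k =>
    scal (pow_n (RtoC t : C_AbsRing) k) (a k : C_NormedModule)) n))).
  by elim=> [|n IHn]; rewrite ?sum_O ?sum_Sn ?[LHS]piD ?IHn termE.
apply: filterlim_comp a_l _ => P [eps Peps].
apply: (@locally_le_locally_norm C_AbsRing C_NormedModule).
exists eps => z; rewrite /ball_norm => lt_z; apply: Peps.
rewrite /ball /= /AbsRing_ball /abs /= /minus /plus /opp /=.
by rewrite [_ + - _](esym (real_functional_minus _ _ pi_lin)); apply: Rle_lt_trans (pi_le _) lt_z.
Qed.

(** Restrict the complex first-order estimate to real increments; applying [pi] does not enlarge the
    remainder. *)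
Lemma derive_real_functional (pi : C -> R) (f : C -> C) (t : R) (l : C) :
  real_functional pi -> has_derive_at f (RtoC t) l ->
  is_derive (fun s : R => pi (f (RtoC s))) t (pi l).
Proof.
move=> pi_lin; have [piD piZ pi_le] := pi_lin => -[_ f_l].
split; first exact: is_linear_scal_l.
move=> x /is_filter_lim_locally_unique <- eps.
have [d d_l] := f_l (RtoC t) (fun P H => H) eps.
exists d => s lt_s.
have -> : minus (minus (pi (f (RtoC s))) (pi (f (RtoC t)))) (scal (minus s t) (pi l)) =
          pi ((f (RtoC s) - f (RtoC t)) - RtoC (s - t) * l)%C.
  by rewrite !(real_functional_minus _ _ pi_lin) piZ.
apply: Rle_trans (pi_le _) _.
have dist : (RtoC s - RtoC t)%C = RtoC (s - t) by rewrite RtoC_minus.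
have := d_l (RtoC s).
rewrite /ball /= /AbsRing_ball /abs /= /minus /plus /opp /scal /norm /= /mult /=.
rewrite [Cplus (RtoC s) (Copp (RtoC t))]dist Cmod_R => /(_ lt_s).
by rewrite [@abs C_AbsRing _]Cmod_R.
Qed.

(** * From differential equations to Taylor coefficients *)

Lemma RtoC_near (P : C -> Prop) :
  near (RtoC 0) P -> exists r : posreal, forall t : R, Rabs t < r -> P (RtoC t).
Proof.
case=> r r_P; exists r => t lt_t; apply: r_P.
split; rewrite /ball /= /AbsRing_ball /abs /= /minus /plus /opp /=.
  by rewrite Ropp_0 Rplus_0_r.
by rewrite Ropp_0 Rplus_0_r Rabs_R0; apply: cond_pos.
Qed.

Lemma near_opp (P : C -> Prop) : near (RtoC 0) P -> near (RtoC 0) (fun z => P (- z)%C).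
Proof.
case=> r r_P; exists r => z [z1 z2]; apply: r_P; move: z1 z2.
rewrite /ball /= /prod_ball /ball /= /AbsRing_ball /abs /= /minus /plus /opp /=.
by rewrite !Ropp_0 !Rplus_0_r !Rabs_Ropp.
Qed.

Lemma near_and (P Q : C -> Prop) :
  near (RtoC 0) P -> near (RtoC 0) Q -> near (RtoC 0) (fun z => P z /\ Q z).
Proof. exact: filter_and. Qed.

(** On the real axis, f' = g^2 splits into its real and imaginary parts. Both sides of each are sums
    of real power series, whose coefficients are then equal by uniqueness. *)
Lemma coef_recurrence (f g : C -> C) (a b : nat -> C) :
  near (RtoC 0) (fun z => has_pseries_at a z (f z)) ->
  near (RtoC 0) (fun z => has_pseries_at b z (g z)) ->
  near (RtoC 0) (fun z => has_derive_at f z (g z * g z)%C) ->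
  let p n := Re (b n) in let q n := Im (b n) in
  forall n, PS_derive (fun n => Re (a n)) n = PS_mult p p n - PS_mult q q n /\
            PS_derive (fun n => Im (a n)) n = PS_mult p q n + PS_mult q p n.
Proof.
move=> a_f b_g f_g p q n.
have [r r_P] := RtoC_near (near_and a_f (near_and b_g f_g)).
have r_gt0 := cond_pos r.
have p_g t : Rabs t < r -> is_pseries p t (Re (g (RtoC t))).
  by move=> /r_P[_ [/(pseries_real_functional real_functional_Re)]].
have q_g t : Rabs t < r -> is_pseries q t (Im (g (RtoC t))).
  by move=> /r_P[_ [/(pseries_real_functional real_functional_Im)]].
have mulE (c d : nat -> R) (h k : R -> R) t :
    (forall t, Rabs t < r -> is_pseries c t (h t)) ->
    (forall t, Rabs t < r -> is_pseries d t (k t)) ->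
    Rabs t < r -> is_pseries (PS_mult c d) t (h t * k t).
  move=> c_h d_k lt_t; apply: is_pseries_mult; auto.
    exact: pseries_radius c_h lt_t.
  exact: pseries_radius d_k lt_t.
have derE pi : real_functional pi -> forall t, Rabs t < r ->
    is_pseries (PS_derive (fun n => pi (a n))) t (pi (g (RtoC t) * g (RtoC t))%C).
  move=> pi_lin t; apply: (@pseries_derive _ (fun t => pi (f (RtoC t)))
                             (fun t => pi (g (RtoC t) * g (RtoC t))%C)) => s /r_P.
    by case=> /(pseries_real_functional pi_lin).
  by case=> _ [_ /(derive_real_functional pi_lin)].
split.
  apply: (pseries_unique (d := PS_minus (PS_mult p p) (PS_mult q q))
    n r_gt0 (derE _ real_functional_Re)) => t lt_t.
  by apply: is_pseries_minus; apply: (mulE _ _ (fun t => _) (fun t => _)).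
apply: (pseries_unique (d := PS_plus (PS_mult p q) (PS_mult q p))
  n r_gt0 (derE _ real_functional_Im)) => t lt_t.
by apply: is_pseries_plus; apply: (mulE _ _ (fun t => _) (fun t => _)).
Qed.

(** For formal series, c(t) = s x(-t) gives c(t)^2 = s^2 x(-t)^2. Only indices up to [n] enter,
    which suits strong induction. *)
Lemma PS_mult_alternating (s : R) (c x : nat -> R) (n : nat) :
  (forall k, (k <= n)%coq_nat -> c k = s * ((-1) ^ k * x k)) ->
  PS_mult c c n = s * s * ((-1) ^ n * PS_mult x x n).
Proof.
move=> c_x; rewrite -Rmult_assoc /PS_mult scal_sum; apply: sum_eq => k le_kn.
rewrite c_x // c_x; last by apply: PeanoNat.Nat.le_sub_l.
have -> : (-1) ^ n = (-1) ^ (n - k)%coq_nat * (-1) ^ k by rewrite -pow_add PeanoNat.Nat.sub_add.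
by ring.
Qed.

Lemma PS_mult_eq0 (c d : nat -> R) (n : nat) :
  (forall k, (k <= n)%coq_nat -> c k = 0) -> PS_mult c d n = 0 /\ PS_mult d c n = 0.
Proof.
move=> c0; rewrite /PS_mult; split.
  by apply: sum_eq_R0 => k le_kn; rewrite c0 // Rmult_0_l.
by apply: sum_eq_R0 => k le_kn; rewrite c0 ?Rmult_0_r //; apply: PeanoNat.Nat.le_sub_l.
Qed.

Lemma pseries_value0 (a : nat -> C) (f : C -> C) :
  near (RtoC 0) (fun z => has_pseries_at a z (f z)) -> a 0%nat = f (RtoC 0).
Proof.
move=> /locally_singleton a_f.
apply: injective_projections.
  have := is_pseries_unique _ _ _ (pseries_real_functional real_functional_Re a_f).
  by rewrite PSeries_0.
have := is_pseries_unique _ _ _ (pseries_real_functional real_functional_Im a_f).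
by rewrite PSeries_0.
Qed.

Lemma near_pseries_0 (f : C -> C) :
  analytic_near (RtoC 0) f ->
  exists a, near (RtoC 0) (fun z => has_pseries_at a z (f z)).
Proof.
case=> a a_f; exists a; apply: filter_imp a_f => z.
by rewrite (_ : z - RtoC 0 = z)%C //; ring.
Qed.

Lemma RtoC_of_parts (z : C) (x : R) : Re z = x -> Im z = 0 -> z = RtoC x.
Proof. by move=> zx z0; apply: injective_projections. Qed.

(** The recurrences determine coefficient n+1 from the earlier ones, and imaginary parts stay zero
    because every product in their recurrence contains an imaginary part. The prefactors -1 and 1
    play the role of [s] in [PS_mult_alternating] and [egf_pseries]. *)
Lemma coef_sm_cm (sm cm : C -> C) (a b : nat -> C) :
  near (RtoC 0) (fun z => has_pseries_at a z (sm z)) ->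
  near (RtoC 0) (fun z => has_pseries_at b z (cm z)) ->
  near (RtoC 0) (fun z => has_derive_at sm z (cm z * cm z)%C) ->
  near (RtoC 0) (fun z => has_derive_at cm z (- (sm z * sm z))%C) ->
  sm (RtoC 0) = RtoC 0 -> cm (RtoC 0) = RtoC 1 ->
  forall n, a n = RtoC (-1 * ((-1) ^ n * coef X n)) /\
            b n = RtoC (1 * ((-1) ^ n * coef Y n)).
Proof.
move=> a_sm b_cm sm' cm' sm0 cm0.
have a_rec := coef_recurrence a_sm b_cm sm'.
(* [- cm] in place of [cm] gives the second equation the shape f' = g^2 of [coef_recurrence]. *)
have b_cm_opp : near (RtoC 0) (fun z => has_pseries_at (fun n => - b n)%C z (- cm z)%C).
  by apply: filter_imp b_cm => z; apply: (@is_pseries_opp C_AbsRing C_NormedModule).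
have cm_opp' : near (RtoC 0) (fun z => has_derive_at (fun z => - cm z)%C z (sm z * sm z)%C).
  apply: filter_imp cm' => z /is_derive_opp.
  by rewrite /has_derive_at [opp _](_ : _ = sm z * sm z)%C //; exact: opp_opp.
have b_rec := coef_recurrence b_cm_opp a_sm cm_opp'.
suff parts n k : (k <= n)%coq_nat ->
    [/\ Re (a k) = -1 * ((-1) ^ k * coef X k), Im (a k) = 0,
        Re (b k) = 1 * ((-1) ^ k * coef Y k) & Im (b k) = 0].
  move=> n; have [uE vE pE qE] := parts n n (le_n n).
  by split; apply: RtoC_of_parts.
elim: n k => [|n IHn] k le_kn.
  have -> : k = 0%nat by apply/eqP; rewrite -leqn0; apply/leP.
  rewrite (pseries_value0 a_sm) (pseries_value0 b_cm) sm0 cm0 /coef X0 Y0 /=.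
  by split; field.
have [lt_kn | le_kn'] := PeanoNat.Nat.le_gt_cases k n; first exact: IHn.
have {k le_kn le_kn'} -> : k = n.+1 by apply: PeanoNat.Nat.le_antisymm.
have [uE vE] := a_rec n; have [pE qE] := b_rec n; move: uE vE pE qE.
have uN k : (k <= n)%coq_nat -> Re (a k) = -1 * ((-1) ^ k * coef X k) by case/IHn.
have vN k : (k <= n)%coq_nat -> Im (a k) = 0 by case/IHn.
have pN k : (k <= n)%coq_nat -> Re (b k) = 1 * ((-1) ^ k * coef Y k) by case/IHn.
have qN k : (k <= n)%coq_nat -> Im (b k) = 0 by case/IHn.
rewrite (PS_mult_alternating uN) (PS_mult_alternating pN).
rewrite !(proj1 (PS_mult_eq0 _ vN)) !(proj2 (PS_mult_eq0 _ vN)).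
rewrite !(proj1 (PS_mult_eq0 _ qN)) !(proj2 (PS_mult_eq0 _ qN)).
rewrite -(coef_PS_derive n X_rec) -(coef_PS_derive n Y_rec) /PS_derive.
have nz : INR (S n) <> 0 by apply: not_0_INR.
(* The factor n+1 comes from [PS_derive] and is cancelled. *)
move=> uE vE pE qE; split; apply: (Rmult_eq_reg_l (INR (S n))) => //.
- by rewrite uE /=; ring.
- by rewrite vE; ring.
- by apply: Ropp_eq_reg; rewrite Ropp_mult_distr_r [- Re _](_ : _ = Re (- b n.+1)%C) // pE /=; ring.
by apply: Ropp_eq_reg; rewrite Ropp_mult_distr_r [- Im _](_ : _ = Im (- b n.+1)%C) // qE; ring.
Qed.

Lemma pow_n_Copp (z : C) (n : nat) :
  @pow_n C_Ring (- z)%C n = (RtoC ((-1) ^ n) * @pow_n C_Ring z n)%C.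
Proof.
elim: n => [|n IHn]; first by rewrite /= Cmult_1_l.
rewrite /= IHn RtoC_mult (_ : RtoC (-1) = - RtoC 1)%C; last by rewrite -RtoC_opp.
by rewrite /mult /=; ring.
Qed.

Lemma pow_sign_sqr (n : nat) : (-1) ^ n * (-1) ^ n = 1.
Proof. by rewrite -Rpow_mult_distr (_ : -1 * -1 = 1) ?pow1 //; ring. Qed.

(** Evaluating at -z produces a second factor (-1)^n that cancels the alternating sign, and scaling
    by [s] cancels the prefactor since s^2 = 1. *)
Lemma egf_pseries (s : R) (u : nat -> nat) (a : nat -> C) (z l : C) :
  s * s = 1 -> (forall n, a n = RtoC (s * ((-1) ^ n * coef u n))) ->
  has_pseries_at a (- z)%C l -> has_pseries_at (egf u) z (RtoC s * l)%C.
Proof.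
move=> s_sqr aE /(is_series_scal (RtoC s : C_AbsRing)).
have cancel_signs (e x : R) (w : C) : e * e = 1 ->
    (RtoC s * (RtoC e * w * RtoC (s * (e * x))))%C = (w * RtoC x)%C.
  move=> e_sqr; transitivity (RtoC (s * s) * RtoC (e * e) * w * RtoC x)%C.
    by rewrite !RtoC_mult; ring.
  by rewrite s_sqr e_sqr; ring.
apply: is_series_ext => n; rewrite pow_n_Copp aE.
exact: cancel_signs (pow_sign_sqr n).
Qed.

End Analysis.

Theorem mainTheorem7 (sm cm : C -> C)
  (sm_analytic : analytic_near (RtoC 0) sm)
  (cm_analytic : analytic_near (RtoC 0) cm)
  (sm_derive : near (RtoC 0) (fun z => has_derive_at sm z (cm z * cm z)%C))
  (cm_derive : near (RtoC 0) (fun z => has_derive_at cm z (- (sm z * sm z))%C))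
  (sm0 : sm (RtoC 0) = RtoC 0)
  (cm0 : cm (RtoC 0) = RtoC 1) :
  near (RtoC 0) (fun z => has_pseries_at (egf X) z (smh sm z)) /\
  near (RtoC 0) (fun z => has_pseries_at (egf Y) z (cmh cm z)).
Proof.
have [a a_sm] := near_pseries_0 sm_analytic.
have [b b_cm] := near_pseries_0 cm_analytic.
have coefE := coef_sm_cm a_sm b_cm sm_derive cm_derive sm0 cm0.
split.
  (* The prefactor is s = -1 for [smh] and s = 1 for [cmh]. *)
  apply: filter_imp (near_opp a_sm) => z a_z.
  have -> : smh sm z = (RtoC (-1) * sm (- z))%C.
    by rewrite /smh (_ : RtoC (-1) = - RtoC 1)%C; [ring | rewrite -RtoC_opp].
  by apply: egf_pseries a_z => [|n]; [ring | have [] := coefE n].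
apply: filter_imp (near_opp b_cm) => z b_z.
rewrite /cmh -[cm _]Cmult_1_l.
by apply: egf_pseries b_z => [|n]; [ring | have [] := coefE n].
Qed.
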